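(* Let $(X,d)$ be a Polish metric space. (1) Let $M\subseteq X$ be a non-empty closed subspace and let $K\ge 1$. If $\Psi:\Omega\times X\to[0,+\infty[$ (together with its measure space $(\Omega,\Sigma,\mathbb{P})$ and its map $\gamma:\Omega\to M$) is a $K$-gentle partition of unity with respect to $M$, then it induces a strong $K$-random projection on $M$; namely, the family $\{\upsilon_x\}_{x\in X}$ defined for Borel $A\subseteq M$ by $$\upsilon_x(A)=\delta_x(A)\ \text{ if } x\in M,\qquad \upsilon_x(A)=\int_{\gamma^{-1}(A)}\Psi(\omega,x)\,d\mathbb{P}(\omega)\ \text{ if } x\in X\setminus M,$$ is a strong $K$-random projection on $M$. (2) In particular, there is a universal constant $C>0$ such that every doubling and Polish metric space $(X,d)$ admits, for every non-empty closed subspace $M\subseteq X$, a strong $C\log(\lambda(X))$-random projection on $M$.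
   Context: Doubling constant: $\lambda(X)$ is the infimum over all natural numbers $\lambda$ such that every ball in $X$ can be covered by $\lambda$ balls of half the radius; $(X,d)$ is doubling if $\lambda(X)<\infty$. $K$-gentle partition of unity: let $M\subseteq X$ be closed, $(\Omega,\Sigma,\mathbb{P})$ a measure space and $K>0$. A function $\Psi:\Omega\times X\to[0,+\infty[$ is a $K$-gentle partition of unity with respect to $M$ if: (i) $\Psi(\cdot,x)\equiv 0$ for all $x\in M$; (ii) for all $x\in X\setminus M$, the function $\Psi(\cdot,x)$ is $\Sigma$-measurable and $\int_\Omega\Psi(\omega,x)\,d\mathbb{P}(\omega)=1$; (iii) there exists a $(\Sigma$-$\mathcal{B}(M))$-measurable function $\gamma:\Omega\to M$, where $\mathcal{B}(M)$ is the Borel $\sigma$-algebra of $M$, such that $\int_\Omega d(\gamma(\omega),x)\,|\Psi(\omega,x)-\Psi(\omega,y)|\,d\mathbb{P}(\omega)\le K\,d(x,y)$ for all $x,y\in X$. $\delta_x$ is the Dirac measure at $x$, and $\mathcal{P}_1(M)$ is the set of Borel probability measures on $M$ with finite first moment. The Wasserstein (Kantorovich-Rubinstein) distance is $W_1(\mu,\eta)=\inf_{\pi}\int_{M\times M}d(x,y)\,d\pi(x,y)$, where $\pi$ ranges over the nonnegative finite Borel measures on $M\times M$ with marginals $\mu$ and $\eta$; by duality it equals $\sup\{\int g\,d\mu-\int g\,d\eta\}$ over $1$-Lipschitz $g:M\to\mathbb{R}$. Strong $K$-random projection on a closed subspace $M\subseteq X$ (with $K\ge 1$): a family $\{\upsilon_x:x\in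 X\}\subseteq\mathcal{P}_1(M)$ such that $\upsilon_x=\delta_x$ for all $x\in M$ and $W_1(\upsilon_x,\upsilon_y)\le K\,d(x,y)$ for all $x,y\in X$.
   Formalization: In (2), the requirement K ≥ 1 for K = C log λ(X) is asserted only when X has at least two points; for a one-point X, λ(X) = 1 gives K = 0, so K ≥ 1 fails for every C, and only the other conditions of a strong K-random projection are claimed there. *)

(* Defs.v *)
From HB Require Import structures.
From mathcomp Require Import all_boot all_order all_algebra.
From mathcomp Require Import all_classical all_reals all_analysis.

Set Implicit Arguments.
Unset Strict Implicit.
Unset Printing Implicit Defensive.

Import Order.TTheory GRing.Theory Num.Theory.
Import numFieldNormedType.Exports.

Local Open Scope classical_set_scope.
Local Open Scope ring_scope.
Local Open Scope ereal_scope.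

(* Metric spaces with a distinguished point. The point plays no mathematical
   role: measurableType extends pointedType, so it is required for a space to
   carry a sigma-algebra. *)
#[short(type="pmetricType")]
HB.structure Definition PointedMetric (K : numDomainType) :=
  { M of Pointed M & Metric K M }.

HB.instance Definition _ (T U : ptopologicalType) := Pointed.on (T * U)%type.

(* The non-empty subset M of X as a metric space of its own, with the induced
   distance; the topology is the subspace topology of [set_type]. *)
Definition subspace_of (X : Type) (M : set X) (M0 : M !=set0) : Type :=
  set_type M.

Section subspace_of_metric.
Context {R : realType} {X : metricType R} (M : set X) (M0 : M !=set0).
Local Notation S := (subspace_of M0).

HB.instance Definition _ := PseudoMetric.copy S (set_type M).

HB.instance Definition _ :=
  isPointed.Build S (exist _ (projT1 (cid M0)) (mem_set (projT2 (cid M0)))).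

Let sdist (x y : S) : R := mdist (set_val x) (set_val y).

Let sdist_ge0 x y : (0 <= sdist x y)%R.
Proof. exact: mdist_ge0. Qed.

Let sdist_positivity x y : sdist x y = 0%R -> x = y.
Proof. by move=> /mdist_positivity; exact: val_inj. Qed.

Let ballEsdist (x : S) (e : R) : ball x e = [set y | (sdist x y < e)%R].
Proof.
by rewrite [LHS](_ : _ = set_val @^-1` ball (set_val x) e)// ballEmdist.
Qed.

HB.instance Definition _ := PseudoMetric_isMetric.Build R S
  sdist_ge0 sdist_positivity ballEsdist.

End subspace_of_metric.

Definition subspace_val (X : Type) (M : set X) (M0 : M !=set0)
  (m : subspace_of M0) : X := set_val m.

Definition borel (T : ptopologicalType) := g_sigma_algebraType (@open T).

Section metric_spaces.
Context {R : realType}.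

(* The first clause is the axiom of the library's completeType. *)
Definition polish (X : metricType R) :=
  (forall F : set_system X, ProperFilter F -> cauchy F -> exists l : X, F --> l) /\
  (exists D : set X, countable D /\ dense D).

Definition half_ball_cover (X : metricType R) (n : nat) :=
  forall (x : X) (r : R), (0 < r)%R ->
    exists c : 'I_n -> X, ball x r `<=` \bigcup_i ball (c i) (r / 2)%R.

(* +oo when no natural number qualifies *)
Definition doubling_constant (X : metricType R) : \bar R :=
  ereal_inf [set (n%:R)%:E | n in half_ball_cover X].

Definition doubling (X : metricType R) := doubling_constant X < +oo.

End metric_spaces.

Section wasserstein.
Context {R : realType} {T : pmetricType R}.

(* By the triangle inequality, for a probability measure this does not depend
   on the choice of x0. *)
Definition finite_first_moment (mu : probability (borel T) R) :=
  exists x0 : T, \int[mu]_x (mdist x0 (x : T))%:E < +oo.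

(* The Borel sigma-algebra of the product topology, not the product
   sigma-algebra. *)
Definition coupling (mu eta : probability (borel T) R) :
    set {finite_measure set (borel (T * T)%type) -> \bar R} :=
  [set pi | forall A : set (borel T), measurable A ->
    pi (A `*` [set: T]) = mu A /\ pi ([set: T] `*` A) = eta A].

Definition wasserstein1 (mu eta : probability (borel T) R) : \bar R :=
  ereal_inf [set \int[pi]_z (mdist (z : T * T).1 (z : T * T).2)%:E
            | pi in coupling mu eta].

End wasserstein.

Section random_projections.
Context {R : realType} {X : metricType R} {M : set X} {M0 : M !=set0}.
Local Notation S := (subspace_of M0).

(* The map gamma, which is existentially quantified in the notion of gentle
   partition of unity, is an explicit argument. *)
Definition gentle_partition (K : R) d (Omega : measurableType d)
    (P : {measure set Omega -> \bar R}) (Psi : Omega -> X -> R)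
    (gamma : Omega -> S) : Prop :=
  [/\ (0 < K)%R /\ (forall w x, (0 <= Psi w x)%R),
      forall w x, M x -> Psi w x = 0%R,
      forall x, ~ M x ->
        measurable_fun [set: Omega] (Psi ^~ x) /\
        \int[P]_w (Psi w x)%:E = 1,
      measurable_fun [set: Omega] (gamma : Omega -> borel S) &
      forall x y : X,
        \int[P]_w (mdist (subspace_val (gamma w)) x *
                   `|Psi w x - Psi w y|)%:E <= (K * mdist x y)%:E].

(* The requirement 1 <= K on the constant is not part of this predicate. *)
Definition strong_random_projection (K : R)
    (upsilon : X -> probability (borel S) R) : Prop :=
  [/\ forall x, finite_first_moment (upsilon x),
      forall (m : S) (A : set (borel S)), measurable A ->
        upsilon (subspace_val m) A = dirac (m : borel S) A &
      forall x y, wasserstein1 (upsilon x) (upsilon y) <= (K * mdist x y)%:E].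

Definition induced_projection d (Omega : measurableType d)
    (P : {measure set Omega -> \bar R}) (Psi : Omega -> X -> R)
    (gamma : Omega -> S) (upsilon : X -> probability (borel S) R) : Prop :=
  (forall (m : S) (A : set (borel S)), measurable A ->
     upsilon (subspace_val m) A = dirac (m : borel S) A) /\
  (forall (x : X) (A : set (borel S)), ~ M x -> measurable A ->
     upsilon x A = \int[P]_(w in gamma @^-1` A) (Psi w x)%:E).

End random_projections.

(* Main.v *)
(* Part (1). For x, y outside M the measures Psi(., x) P and Psi(., y) P share
   the mass min(Psi(., x), Psi(., y)) P, which is left in place on the diagonal;
   the excesses, of equal mass, are coupled by their normalised product. Through
   x, the product costs at most the integral of d(gamma, x)|Psi(., x) - Psi(., y)|.

   Part (2). No random partition is needed. Take a Whitney net (z_i) of the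
   complement of M (spacing about dist(z_i, M)/8), let gamma i be a nearly closest
   point of M to z_i, and normalise the weights
     max(0, exp(-A t) - exp(-A/2)),   t = d(x, z_i) / dist(x, M),
   with A = 16 ln L, where L is the doubling constant. Only net points with
   t < 1/2 matter, there are at most L^4 of them, and exp(-A/2) = L^-8 while some
   point has t <= 1/4 and exp(-A/4) = L^-4; so the truncation costs only a constant
   factor, and the logarithmic derivative of the weights is O(A / dist(x, M)). *)
Require Import Defs.
From HB Require Import structures.
From mathcomp Require Import all_boot all_order all_algebra.
From mathcomp Require Import all_classical all_reals all_analysis.
From mathcomp Require Import measurable_realfun.
From mathcomp Require Import ring lra zify.

Set Implicit Arguments.
Unset Strict Implicit.
Unset Printing Implicit Defensive.

Import Order.TTheory GRing.Theory Num.Theory.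
Import numFieldNormedType.Exports.

Local Open Scope classical_set_scope.
Local Open Scope ring_scope.

(** * Measures with a density, and their images *)

Section image_of_density.
Local Open Scope ereal_scope.
Context d d' (W : measurableType d) (T : measurableType d') (R : realType).
Variables (P : {measure set W -> \bar R}) (f : W -> R) (phi : W -> T).
Hypotheses (mf : measurable_fun [set: W] f) (f0 : forall w, (0 <= f w)%R).
Hypothesis fy : \int[P]_w (f w)%:E < +oo.
Hypothesis mphi : measurable_fun [set: W] phi.

Definition density_image (A : set T) := \int[P]_(w in phi @^-1` A) (f w)%:E.
Local Notation nu := density_image.

Let mpre A : measurable A -> measurable (phi @^-1` A).
Proof. by move=> mA; rewrite -[X in measurable X]setTI; exact: mphi. Qed.

Let nu0 : nu set0 = 0.
Proof. by rewrite /nu preimage_set0 integral_set0. Qed.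

Let nu_ge0 A : 0 <= nu A.
Proof. by apply: integral_ge0 => w _; rewrite lee_fin. Qed.

Let nu_sigma : semi_sigma_additive nu.
Proof.
move=> F mF tF mUF; rewrite /nu preimage_bigcup.
apply: (@semi_sigma_additive_nng_induced _ W R P (EFin \o f)) => //=.
- exact/measurable_EFinP.
- by move=> n; exact: mpre.
- apply/trivIsetP => /= i j _ _ ij; rewrite -preimage_setI.
  by move/trivIsetP : tF => /(_ _ _ _ _ ij) ->//; rewrite preimage_set0.
- by rewrite -preimage_bigcup; exact: mpre.
Qed.

HB.instance Definition _ := isMeasure.Build _ _ _ nu nu0 nu_ge0 nu_sigma.

Let nu_fin : fin_num_fun nu.
Proof.
move=> A mA; rewrite ge0_fin_numE//; apply: le_lt_trans fy.
apply: ge0_subset_integral => //; first exact: mpre.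
  exact/measurable_EFinP.
by move=> w _; rewrite lee_fin.
Qed.

HB.instance Definition _ := @Measure_isFinite.Build _ T _ nu nu_fin.

Import HBNNSimple.

Let indic_image (A : set T) : measurable A ->
  \int[nu]_t (\1_A t)%:E = \int[P]_w ((\1_A (phi w))%:E * (f w)%:E).
Proof.
move=> mA; rewrite integral_indic// setIT /nu [LHS]integral_mkcond.
apply: eq_integral => w _; rewrite patchE indicE.
rewrite (_ : (w \in phi @^-1` A) = (phi w \in A)); last by [].
by case: ifPn; rewrite ?mul1e ?mul0e.
Qed.

Let sfun_image (h : {nnsfun T >-> R}) :
  \int[nu]_t (h t)%:E = \int[P]_w ((h (phi w))%:E * (f w)%:E).
Proof.
under [LHS]eq_integral do rewrite fimfunE -fsumEFin//.
rewrite ge0_integral_fsum//; last 2 first.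
  - by move=> r; exact/measurable_EFinP/measurable_funM.
  - by move=> r t _; exact: nnfun_muleindic_ge0.
under [RHS]eq_integral.
  move=> w _; rewrite fimfunE -fsumEFin// ge0_mule_fsuml; last first.
    by move=> r; exact: nnfun_muleindic_ge0.
  over.
rewrite ge0_integral_fsum//; last 2 first.
  - move=> r; apply: emeasurable_funM; last exact/measurable_EFinP.
    apply/measurable_EFinP/measurable_funM => //.
    by apply: measurableT_comp => //; exact: measurable_indic.
  - by move=> r t _; rewrite mule_ge0 ?lee_fin//; exact: nnfun_muleindic_ge0.
apply: eq_fsbigr => r; rewrite inE => -[t _ htr].
have r0 : (0 <= r)%R by rewrite -htr; exact: fun_ge0.
under [LHS]eq_integral do rewrite EFinM.
rewrite ge0_integralZl_EFin//; last first.
  exact/measurable_EFinP/measurable_indic.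
rewrite indic_image//; under [RHS]eq_integral do rewrite EFinM -muleA.
rewrite ge0_integralZl_EFin//.
  by move=> w _; rewrite mule_ge0 ?lee_fin.
apply: emeasurable_funM; last exact/measurable_EFinP.
by apply/measurable_EFinP; apply: measurableT_comp => //; exact: measurable_indic.
Qed.

Let ge0_image (g : T -> \bar R) : measurable_fun [set: T] g ->
  (forall t, 0 <= g t) -> \int[nu]_t g t = \int[P]_w (g (phi w) * (f w)%:E).
Proof.
move=> mg g0; pose h := nnsfun_approx measurableT mg.
have gE t : g t = limn (fun n => (h n t)%:E).
  by apply/esym/cvg_lim => //; exact: cvg_nnsfun_approx.
under [LHS]eq_integral do rewrite gE.
rewrite monotone_convergence//; last 3 first.
  - by move=> n; exact/measurable_EFinP.
  - by move=> n t _; rewrite lee_fin.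
  - by move=> t _ a b ab; rewrite lee_fin; exact/lefP/nd_nnsfun_approx.
have gfE w : g (phi w) * (f w)%:E =
    limn (fun n => (h n (phi w))%:E * (f w)%:E).
  apply/esym/cvg_lim => //; apply: cvgeZr => //.
  exact: cvg_nnsfun_approx.
under [RHS]eq_integral do rewrite gfE.
rewrite monotone_convergence//; last 3 first.
  - move=> n; apply: emeasurable_funM; last exact/measurable_EFinP.
    by apply/measurable_EFinP; exact: measurableT_comp.
  - by move=> n w _; rewrite mule_ge0 ?lee_fin.
  - move=> w _ a b ab; rewrite lee_wpmul2r ?lee_fin//.
    exact/lefP/nd_nnsfun_approx.
by congr (limn _); apply/funext => n; rewrite sfun_image.
Qed.

(** The measure is [density_image], finite by [fy]; the change of variables passes from indicators
    to simple functions and then to monotone limits. Both are returned together because later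
    constructions need the integral formula as well as the values on sets. *)
Lemma image_density : exists mu : {finite_measure set T -> \bar R},
  (forall A, measurable A -> mu A = \int[P]_(w in phi @^-1` A) (f w)%:E) /\
  (forall g : T -> \bar R, measurable_fun [set: T] g -> (forall t, 0 <= g t) ->
     \int[mu]_t g t = \int[P]_w (g (phi w) * (f w)%:E)).
Proof. by exists nu; split => // g mg g0; exact: ge0_image. Qed.

End image_of_density.

Section finite_measure_probability.
Context d (T : measurableType d) (R : realType).
Variables (mu : {finite_measure set T -> \bar R}) (mu1 : mu [set: T] = 1%E).

(** A fresh name for [mu], to which the probability structure obtained from [mu1] can be
    attached. *)
Definition measure_copy : set T -> \bar R := mu.
Local Notation nu := measure_copy.

HB.instance Definition _ := FiniteMeasure.on nu.

HB.instance Definition _ := Measure_isProbability.Build _ _ _ nu mu1.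

Lemma finite_measure_probability :
  exists nu : probability T R, nu = mu :> (set T -> \bar R).
Proof. by exists nu. Qed.

End finite_measure_probability.

(** * Borel sets of separable metric spaces *)

Definition dense_sequence (R : realType) (T : metricType R) (s : nat -> T) :=
  forall (x : T) (e : R), 0 < e -> exists i, mdist x (s i) < e.

Lemma polish_dense_sequence (R : realType) (X : metricType R) (x0 : X) :
  polish X -> exists s : nat -> X, dense_sequence s.
Proof.
move=> [_ [D [/countable_injP[f finj] denD]]].
(* The index [i] names the only point of [D] with code [i], by injectivity of [f] on [D], and [x0]
   if there is none. *)
exists (fun i => xget x0 [set x | D x /\ f x = i]) => x e e0.
have [] := denD (ball x e)^°.
- by exists x; exact: nbhsx_ballx.
- exact: open_interior.
move=> y [/interior_subset xy Dy]; exists (f y).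
case: xgetP => [z _ [Dz fzy]|/(_ y)]; last by case.
have -> : z = y by apply: finj; rewrite ?inE.
by move: xy; rewrite ballEmdist.
Qed.

Lemma mdist_subspace (R : realType) (X : metricType R) (M : set X)
    (M0 : M !=set0) (m m' : subspace_of M0) :
  mdist m m' = mdist (subspace_val m) (subspace_val m').
Proof. by []. Qed.

(** The sequence [s] may miss [M] altogether. For each pair [(i, n)] a point of [M] within [1/(n+1)]
    of [s i] is chosen if there is one; pairs are coded by natural numbers. *)
Lemma subspace_dense_sequence (R : realType) (X : metricType R) (M : set X)
    (M0 : M !=set0) (s : nat -> X) : dense_sequence s ->
  exists t : nat -> subspace_of M0, dense_sequence t.
Proof.
move=> dens.
pose near_s (ij : nat * nat) : set (subspace_of M0) :=
  [set m | mdist (s ij.1) (subspace_val m) < ij.2.+1%:R^-1].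
exists (fun k => xget point (near_s (odflt (0, 0)%N (choice.unpickle k)))) => m e e0.
have e20 : 0 < e / 2 by rewrite divr_gt0.
have [n /= ne] : exists n : nat, n.+1%:R^-1 < e / 2.
  exists (Num.truncn (e / 2)^-1); rewrite invf_plt ?posrE//.
  exact: truncnS_gt.
have [i mi] := dens (subspace_val m) n.+1%:R^-1 ltac:(by rewrite invr_gt0).
exists (choice.pickle (i, n)); rewrite choice.pickleK/=.
case: xgetP => [z _|/(_ m)]; last by rewrite /near_s/= metric_sym.
rewrite /near_s/= => iz.
rewrite mdist_subspace; apply: (le_lt_trans (metric_triangle _ (s i) _)).
by rewrite (splitr e) ltrD// (lt_trans _ ne).
Qed.

Section borel_metric.
Context (R : realType).

Lemma continuous_borel_measurable (T : ptopologicalType) (f : T -> R) :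
  continuous f -> measurable_fun [set: borel T] (f : borel T -> R).
Proof.
move=> /continuousP cf; apply: (measurability _ (RGenOpens.measurableE R)).
move=> _ [_ [a [b ->] <-]]; rewrite setTI.
by apply: sub_sigma_algebra; exact/cf/interval_open.
Qed.

Lemma mdist_pair_continuous (T : metricType R) :
  continuous (fun z : T * T => mdist z.1 z.2).
Proof.
move=> [x y]; apply/cvgrPdist_lt => e e0.
have e20 : 0 < e / 2 by rewrite divr_gt0.
exists (ball x (e / 2), ball y (e / 2)); first by split; exact: nbhsx_ballx.
move=> [x' y'] /= []; rewrite !ballEmdist /= => xx' yy'.
have := metric_triangle x x' y; have := metric_triangle x' y' y.
have := metric_triangle x' x y'; have := metric_triangle x y y'.
rewrite (metric_sym x' x) (metric_sym y' y) ltr_norml.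
by move: xx' yy' => *; apply/andP; split; lra.
Qed.

Lemma mdist_continuous (T : metricType R) (x : T) : continuous (mdist x).
Proof.
move=> y; apply: (@continuous_comp _ _ _ (pair x) (fun z => mdist z.1 z.2)).
  by apply: cvg_pair => //=; exact: cvg_cst.
exact: mdist_pair_continuous.
Qed.

(** Separability puts the Borel sets of the product topology inside the product sigma-algebra: an
    open set is the countable union of the squares of equal-radius balls, centred on the dense
    sequence with radii [1/(n+1)], that it contains. *)
Lemma borel_pair_measurable (T : pmetricType R) (s : nat -> T) :
  dense_sequence s ->
  measurable_fun [set: borel T * borel T]
    (id : borel T * borel T -> borel (T * T)%type).
Proof.
move=> dens.
apply: (@measurability _ _ (borel T * borel T)%type (borel (T * T)%type)
  [set: borel T * borel T] id (@open (T * T)%type) erefl).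
move=> _ [U oU <-]; rewrite setTI.
pose rect (c : nat * nat * nat) : set (T * T) :=
  ball (s c.1.1) c.2.+1%:R^-1 `*` ball (s c.1.2) c.2.+1%:R^-1.
have mball (x : T) (e : R) : measurable (ball x e : set (borel T)).
  rewrite ballEmdist -[X in measurable X]setTI.
  rewrite [X in _ `&` X](_ : _ = (mdist x : borel T -> R) @^-1` `]-oo, e[%classic).
    apply: continuous_borel_measurable => //; exact: mdist_continuous.
  by apply/seteqP; split => y /=; rewrite in_itv.
(* A number that codes no triple falls back on [(0, 0, 0)]; this is harmless, since a square is kept
   only if it lies in [U]. *)
pose F k := let c := odflt (0, 0, 0)%N (choice.unpickle k) in
  if `[< rect c `<=` U >] then rect c else set0.
suff -> : id @^-1` U = \bigcup_k F k.
  apply: bigcupT_measurable => k; rewrite /F.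
  by case: ifPn => // _; exact: measurableX.
apply/seteqP; split => [[x y] Uxy|z [k _]]; last first.
  by rewrite /F; case: ifPn => // /asboolP; apply.
have /= [[A B] [/= /nbhs_ballP[a /= a0 xA] /nbhs_ballP[b /= b0 yB]] ABU] :
  nbhs (x, y) U by exact: open_nbhs_nbhs.
pose e := Num.min a b; have e0 : 0 < e by rewrite lt_min a0 b0.
have e20 : 0 < e / 2 by rewrite divr_gt0.
have [n /= ne] : exists n : nat, n.+1%:R^-1 < e / 2.
  exists (Num.truncn (e / 2)^-1); rewrite invf_plt ?posrE//.
  exact: truncnS_gt.
have n0 : 0 < n.+1%:R^-1 :> R by rewrite invr_gt0.
have [i xi] := dens x _ n0; have [j yj] := dens y _ n0.
have near (z u v : T) : mdist z u < n.+1%:R^-1 -> mdist u v < n.+1%:R^-1 ->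
    mdist z v < e.
  move=> zu uv; apply: (le_lt_trans (metric_triangle _ u _)).
  by rewrite (splitr e) ltrD// (lt_trans _ ne).
exists (choice.pickle (i, j, n)) => //; rewrite /F choice.pickleK/= asboolT.
  by split; rewrite /= ballEmdist/= metric_sym.
move=> [u v] [/=]; rewrite !ballEmdist/= => su sv; apply: ABU; split => /=.
  apply: xA; rewrite ballEmdist/= (lt_le_trans (near _ _ _ xi su))//.
  by rewrite ge_min lexx.
apply: yB; rewrite ballEmdist/= (lt_le_trans (near _ _ _ yj sv))//.
by rewrite ge_min lexx orbT.
Qed.

End borel_metric.

Lemma continuous_borel_measurable2 (T U : ptopologicalType) (f : T -> U) :
  continuous f -> measurable_fun [set: borel T] (f : borel T -> borel U).
Proof.
move=> /continuousP cf.
apply: (@measurability _ _ (borel T) (borel U) [set: borel T] f (@open U) erefl).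
by move=> _ [V oV <-]; rewrite setTI; apply: sub_sigma_algebra; exact: cf.
Qed.

(** This is [image_density] for the density 1 and the identity map; it equips a measure of finite
    mass with the structure that couplings demand. *)
Lemma finite_measure_of (d : measure_display) (T : measurableType d)
    (R : realType) (P : {measure set T -> \bar R}) : (P [set: T] < +oo)%E ->
  exists mu : {finite_measure set T -> \bar R},
    forall A, measurable A -> mu A = P A.
Proof.
move=> Py.
have fy : (\int[P]_w (cst 1%R w)%:E < +oo)%E.
  by rewrite -[ltLHS]/(\int[P]_w cst 1%E w)%E integral_cst// mul1e.
have m1 : measurable_fun [set: T] (cst 1%R : T -> R) by [].
have [mu [muE _]] := image_density m1 (fun _ => ler01) fy
  (@measurable_id _ T setT).
exists mu => A mA; rewrite muE// preimage_id.
by rewrite -[LHS]/(\int[P]_(w in A) cst 1%E w)%E integral_cst// mul1e.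
Qed.

Lemma finite_product_measure d1 d2 (T1 : measurableType d1)
    (T2 : measurableType d2) (R : realType)
    (a : {finite_measure set T1 -> \bar R})
    (b : {finite_measure set T2 -> \bar R}) :
  ((a \x b) [set: T1 * T2] < +oo)%E.
Proof.
rewrite -setXTT product_measure1E//.
by rewrite -ge0_fin_numE ?mule_ge0// fin_numM// fin_num_measure.
Qed.

(** * Couplings and the Wasserstein distance *)

Section couplings.
Local Open Scope ereal_scope.
Context (R : realType) (T : pmetricType R) (s : nat -> T).
Hypothesis dens : dense_sequence s.

Let idb : borel T * borel T -> borel (T * T)%type := id.

Let midb : measurable_fun [set: borel T * borel T] idb.
Proof. exact: borel_pair_measurable dens. Qed.

Let cost : borel (T * T)%type -> \bar R :=
  fun z => (mdist (z : T * T).1 (z : T * T).2)%:E.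

Let mcost : measurable_fun [set: borel (T * T)%type] cost.
Proof.
apply/measurable_EFinP.
apply: (continuous_borel_measurable (@mdist_pair_continuous R T)).
Qed.

Let cost_ge0 z : 0 <= cost z.
Proof. by rewrite lee_fin mdist_ge0. Qed.

Let borel_rectangle (A B : set (borel T)) : measurable A -> measurable B ->
  measurable (A `*` B : set (borel (T * T)%type)).
Proof.
move=> mA mB; rewrite -[X in measurable X]setTI.
have mfst : measurable_fun [set: borel (T * T)%type]
    (fst : borel (T * T)%type -> borel T).
  by apply: continuous_borel_measurable2 => z; exact: cvg_fst.
have msnd : measurable_fun [set: borel (T * T)%type]
    (snd : borel (T * T)%type -> borel T).
  by apply: continuous_borel_measurable2 => z; exact: cvg_snd.
rewrite (_ : _ `&` _ = ([set: T * T] `&` fst @^-1` A) `&`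
   ([set: T * T] `&` snd @^-1` B)); last by rewrite !setTI.
by apply: measurableI; [exact: mfst|exact: msnd].
Qed.

(** The product measure lives on the product sigma-algebra while couplings are measures on
    [borel (T * T)]; the image under the measurable identity [idb] moves it there, and Tonelli
    computes its integrals. *)
Lemma borel_product (a b : {finite_measure set (borel T) -> \bar R}) :
  exists pi : {finite_measure set (borel (T * T)%type) -> \bar R},
    (forall A B : set (borel T), measurable A -> measurable B ->
       pi (A `*` B) = a A * b B) /\
    (forall h : borel (T * T)%type -> \bar R,
       measurable_fun [set: borel (T * T)%type] h -> (forall z, 0 <= h z) ->
       \int[pi]_z h z = \int[a]_x \int[b]_y h (x, y)).
Proof.
have fy : \int[a \x b]_z (cst 1%R z)%:E < +oo.
  rewrite -[ltLHS]/(\int[a \x b]_w cst 1%E w) integral_cst// mul1e.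
  exact: finite_product_measure.
have m1 : measurable_fun [set: borel T * borel T] (cst 1%R : _ -> R) by [].
have [pi [piE pi_int]] := image_density m1 (fun _ => ler01) fy midb.
exists pi; split => [A B mA mB|h mh h0].
  rewrite piE; last exact: borel_rectangle.
  rewrite preimage_id -[LHS]/(\int[a \x b]_(w in A `*` B) cst 1%E w)%E.
  rewrite integral_cst; last exact: measurableX.
  by rewrite mul1e; exact: product_measure1E.
rewrite pi_int//; under eq_integral do rewrite mule1.
rewrite (fubini_tonelli1 (h \o idb))//.
exact: measurableT_comp.
Qed.

Lemma measurable_integral_mdist (b : {finite_measure set (borel T) -> \bar R}) :
  measurable_fun [set: borel T]
    (fun x : borel T => \int[b]_y (mdist (x : T) (y : T))%:E).
Proof.
apply: (@measurable_fun_fubini_tonelli_F _ _ _ _ _ b (cost \o idb)) => //.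
exact: measurableT_comp.
Qed.

(** The independent coupling is a competitor in the infimum. It is used when one of the two measures
    is a Dirac mass. *)
Lemma wasserstein1_product (mu eta : probability (borel T) R) :
  wasserstein1 mu eta <= \int[mu]_x \int[eta]_y (mdist (x : T) (y : T))%:E.
Proof.
have [pi [piE pi_int]] := borel_product mu eta.
apply: ereal_inf_lbound; exists pi; last by rewrite (pi_int cost).
move=> A mA; split.
  by rewrite -[RHS]mule1 -(probability_setT eta); exact: piE.
by rewrite -[RHS]mul1e -(probability_setT mu); exact: piE.
Qed.

(** The common part [m] stays on the diagonal at no cost, and the excesses [a] and [b], of equal
    mass [k], are coupled by [a x b / k]. Since [mdist u v <= D u + D v], the two variables separate
    in the cost of the product. *)
Lemma wasserstein1_coupling_sum (mu eta : probability (borel T) R)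
    (m a b : {finite_measure set (borel T) -> \bar R}) :
  a [set: T] = b [set: T] ->
  (forall A : set (borel T), measurable A -> mu A = m A + a A) ->
  (forall A : set (borel T), measurable A -> eta A = m A + b A) ->
  forall D : T -> R, measurable_fun [set: borel T] (D : borel T -> R) ->
  (forall u, (0 <= D u)%R) -> (forall u v, (mdist u v <= D u + D v)%R) ->
  wasserstein1 mu eta <= \int[a]_u (D u)%:E + \int[b]_u (D u)%:E.
Proof.
move=> ab muE etaE D mD D0 dD.
have afin := @fin_num_measure _ _ _ a setT measurableT.
set k := fine (a setT); have k0 : (0 <= k)%R by exact: fine_ge0.
have aE : a setT = k%:E by rewrite fineK.
have bE : b setT = k%:E by rewrite -ab.
pose c : {nonneg R} := NngNum (ltac:(by rewrite invr_ge0) : 0 <= k^-1)%R.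
have cE : c%:num%R = k^-1%R by [].
(* This covers [k = 0] too: then [k^-1 = 0], and [r <= k] forces [r = 0]. *)
have kcM (r : \bar R) : r <= k%:E -> 0 <= r -> c%:num%:E * (r * k%:E) = r.
  move=> rk r0; rewrite cE.
  have [k_eq0|k_neq0] := eqVneq k 0%R; last first.
    by rewrite muleCA -EFinM mulVf// mule1.
  rewrite k_eq0 mule0 mule0; apply/eqP; rewrite eq_le r0/=.
  by rewrite k_eq0 in rk.
have [pr [prE pr_int]] := borel_product a b.
have mdiag : measurable_fun [set: borel T]
    ((fun u => (u, u)) : borel T -> borel (T * T)%type).
  by apply: continuous_borel_measurable2 => u; apply: cvg_pair; exact: cvg_id.
have m1 : measurable_fun [set: borel T] (cst 1%R : _ -> R) by [].
have fy : \int[m]_z (cst 1%R z)%:E < +oo.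
  rewrite -[ltLHS]/(\int[m]_w cst 1%E w) integral_cst// mul1e.
  by rewrite -ge0_fin_numE// fin_num_measure.
have [dg [dgE dg_int]] := image_density m1 (fun _ => ler01) fy mdiag.
have dgX (A B : set (borel T)) : measurable A -> measurable B ->
    dg (A `*` B) = m (A `&` B).
  move=> mA mB; rewrite dgE; last exact: borel_rectangle.
  rewrite -[LHS]/(\int[m]_(u in A `&` B) cst 1%E u).
  by rewrite integral_cst ?mul1e//; exact: measurableI.
(* The coupling: the diagonal image of [m] plus the normalised product of the excesses. *)
pose sm : {measure set (borel (T * T)%type) -> \bar R} :=
  measure_add dg (mscale c pr).
have smE A : sm A = dg A + c%:num%:E * pr A by exact: (measure_addE dg (mscale c pr)).
have sy : sm setT < +oo.
  rewrite smE -ge0_fin_numE ?adde_ge0 ?mule_ge0//.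
  by rewrite fin_numD fin_numM// !fin_num_measure.
have [pi piE] := finite_measure_of sy.
apply: (@le_trans _ _ (\int[pi]_z cost z)).
  apply: ereal_inf_lbound; exists pi => // A mA; split.
    transitivity (sm (A `*` setT)).
      by apply: piE; exact: borel_rectangle.
    rewrite smE dgX// setIT muE//; congr (_ + _).
    rewrite prE// bE kcM// -aE.
    by apply: le_measure; rewrite ?inE.
  transitivity (sm (setT `*` A)).
    by apply: piE; exact: borel_rectangle.
  rewrite smE dgX// setTI etaE//; congr (_ + _).
  rewrite prE// aE (muleC k%:E) kcM// -bE.
  by apply: le_measure; rewrite ?inE.
rewrite (eq_measure_integral sm); last first.
  by move=> A mA _; exact: piE.
rewrite ge0_integral_measure_add//.
rewrite dg_int// [X in X + _](_ : _ = 0) ?add0e; last first.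
  by rewrite integral0_eq// => u _; rewrite /cost/= mdistxx mul0e.
rewrite ge0_integral_mscale// pr_int//.
have mDE : measurable_fun [set: borel T] (fun u : borel T => (D u)%:E).
  exact/measurable_EFinP.
have DE0 u : 0 <= (D u)%:E by rewrite lee_fin.
set A0 := \int[a]_u (D u)%:E; set B0 := \int[b]_u (D u)%:E.
have B00 : 0 <= B0 by apply: integral_ge0 => u _; exact: DE0.
have A00 : 0 <= A0 by apply: integral_ge0 => u _; exact: DE0.
have mcost1 (x : borel T) :
    measurable_fun [set: borel T] (fun y : borel T => cost (x, y)).
  apply/measurable_EFinP; apply: continuous_borel_measurable.
  exact: mdist_continuous.
have mcost2 := measurable_integral_mdist b.
have mDk : measurable_fun [set: borel T] (fun x : borel T => (D x)%:E * k%:E).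
  exact: emeasurable_funM.
have Dk0 x : 0 <= (D x)%:E * k%:E by rewrite mule_ge0.
(* Integrating [D x + D y] over [b] gives [D x * k + B0]; integrating over [a] then gives
   [(A0 + B0) * k], and the factor [c] cancels [k]. *)
have inner (x : borel T) :
    \int[b]_y cost (x, y) <= (D x)%:E * k%:E + B0.
  apply: (@le_trans _ _ (\int[b]_y ((D x)%:E + (D y)%:E))).
    apply: ge0_le_integral => //.
    - exact: emeasurable_funD.
    - by move=> y _; rewrite -EFinD lee_fin.
  by rewrite ge0_integralD// integral_cst// -bE.
apply: (@le_trans _ _ (c%:num%:E * \int[a]_x ((D x)%:E * k%:E + B0))).
  apply: lee_wpmul2l => //; apply: ge0_le_integral => //.
  - by move=> x _; exact: integral_ge0.
  - exact: emeasurable_funD.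
rewrite ge0_integralD// ge0_integralZr// integral_cst//.
apply: (@le_trans _ _ (c%:num%:E * ((A0 + B0) * k%:E))).
  apply: lee_wpmul2l => //.
  rewrite (_ : (A0 + B0) * k%:E = A0 * k%:E + B0 * k%:E).
    by rewrite -aE.
  exact: ge0_muleDl.
have [k_eq0|k_neq0] := eqVneq k 0%R.
  by rewrite cE k_eq0 invr0 mul0e adde_ge0.
by rewrite cE muleCA -EFinM mulVf// mule1.
Qed.

End couplings.

Lemma nonexpansive_continuous (R : realType) (T : metricType R) (f : T -> R) :
  (forall u v, `|f u - f v| <= mdist u v) -> continuous f.
Proof.
move=> flip u; apply/cvgrPdist_lt => e e0.
apply/nbhs_ballP; exists e => //= v; rewrite ballEmdist/=.
exact: le_lt_trans.
Qed.

Lemma integral_eq_dirac (d : measure_display) (T : measurableType d)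
    (R : realType) (mu : {measure set T -> \bar R}) (t : T) :
  (forall A, measurable A -> mu A = dirac t A) ->
  forall h : T -> \bar R, measurable_fun [set: T] h ->
  (\int[mu]_u h u = h t)%E.
Proof.
move=> muE h mh; rewrite (eq_measure_integral (dirac t))//; last first.
  by move=> A mA _; exact: muE.
by rewrite integral_dirac// diracT mul1e.
Qed.

(** * The random projection induced by a gentle partition *)

Section induced_random_projection.
Local Open Scope ereal_scope.
Context (R : realType) (X : metricType R) (M : set X) (M0 : M !=set0).
Local Notation S := (subspace_of M0).
Variable (s : nat -> S).
Hypothesis dens : dense_sequence s.
Context (K : R) d (Omega : measurableType d) (P : {measure set Omega -> \bar R}).
Variables (Psi : Omega -> X -> R) (gamma : Omega -> S).
Hypotheses (K1 : (1 <= K)%R) (gentle : gentle_partition K P Psi gamma).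

Let Psi0 w x : (0 <= Psi w x)%R.
Proof. by case: gentle => -[]. Qed.

Let PsiM w x : M x -> Psi w x = 0%R.
Proof. by case: gentle => _ + _ _ _; exact. Qed.

Let mPsi x : ~ M x -> measurable_fun [set: Omega] (Psi ^~ x).
Proof. by case: gentle => _ _ + _ _ => /[apply] -[]. Qed.

Let PsiE x : ~ M x -> \int[P]_w (Psi w x)%:E = 1.
Proof. by case: gentle => _ _ + _ _ => /[apply] -[]. Qed.

Let mgamma : measurable_fun [set: Omega] (gamma : Omega -> borel S).
Proof. by case: gentle. Qed.

Let subspace_valM (m : S) : M (subspace_val m).
Proof. exact: set_valP. Qed.

Let dist_to (x : X) (m : S) : R := mdist (subspace_val m) x.

Let mdist_to x : measurable_fun [set: borel S] (dist_to x : borel S -> R).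
Proof.
apply: (@continuous_borel_measurable R S).
apply: nonexpansive_continuous => m m'.
rewrite mdist_subspace /dist_to; set u := subspace_val m; set v := subspace_val m'.
have := metric_triangle u v x; have := metric_triangle v u x.
rewrite (metric_sym v u) ler_norml => *.
by apply/andP; split; lra.
Qed.

Let dist_to_ge0 x m : (0 <= dist_to x m)%R.
Proof. exact: mdist_ge0. Qed.

Let mdist_gamma x : measurable_fun [set: Omega] (fun w => dist_to x (gamma w)).
Proof.
have mT : measurable [set: borel S] by exact: measurableT.
exact: (measurable_comp mT (@subsetT _ _) (mdist_to x) mgamma).
Qed.

(** Apply the gentle inequality to the pair [m], [x]: since [Psi] vanishes at [m], the absolute
    difference is just [Psi w x]. *)
Let moment (m : S) (x : X) : ~ M x ->
  \int[P]_w ((dist_to (subspace_val m) (gamma w))%:E * (Psi w x)%:E) <=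
  (K * mdist (subspace_val m) x)%:E.
Proof.
move=> Mx; case: gentle => _ _ _ _ /(_ (subspace_val m) x); apply: le_trans.
rewrite le_eqVlt; apply/orP; left; apply/eqP; apply: eq_integral => w _.
by rewrite (PsiM w (subspace_valM m)) sub0r normrN ger0_norm// EFinM.
Qed.

(** The integral formula is recorded next to the values on sets because the measures are later
    picked by [choice], which forgets how they were built. *)
Let is_projection (x : X) (nu : probability (borel S) R) :=
  (forall (m : S), subspace_val m = x ->
    forall A : set (borel S), measurable A -> nu A = dirac (m : borel S) A) /\
  (~ M x ->
    (forall A : set (borel S), measurable A ->
      nu A = \int[P]_(w in gamma @^-1` A) (Psi w x)%:E) /\
    (forall g : borel S -> \bar R, measurable_fun [set: borel S] g ->
      (forall m, 0 <= g m) ->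
      \int[nu]_m g m = \int[P]_w (g (gamma w) * (Psi w x)%:E))).

Let projection_exists x : exists nu, is_projection x nu.
Proof.
have [Mx|Mx] := pselect (M x).
  pose m : S := exist _ x (mem_set Mx).
  exists (dirac (m : borel S)); split => // m' m'x A mA.
  by have -> : m' = m by apply: val_inj; exact: m'x.
have Psiy : \int[P]_w (Psi w x)%:E < +oo by rewrite PsiE// ltry.
have [mu [muE mu_int]] := image_density (mPsi Mx) (Psi0 ^~ x) Psiy mgamma.
have mu1 : mu setT = 1 by rewrite muE// PsiE.
have [nu nuE] := finite_measure_probability mu1.
exists nu; split => [m mx|_]; first by case: Mx; rewrite -mx.
by rewrite nuE; split.
Qed.

Let split_coupling x y (mu eta : probability (borel S) R) :
  ~ M x -> ~ M y -> is_projection x mu -> is_projection y eta ->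
  wasserstein1 mu eta <= (K * mdist x y)%:E.
Proof.
move=> Mx My [_ /(_ Mx)[muE _]] [_ /(_ My)[etaE _]].
(* The shared density and the two excesses; their images under [gamma] are the measures [m], [a] and
   [b] of [wasserstein1_coupling_sum], with [D] the distance to [x]. *)
pose f0 w := Num.min (Psi w x) (Psi w y).
pose f1 w := (Psi w x - f0 w)%R; pose f2 w := (Psi w y - f0 w)%R.
have mf0 : measurable_fun [set: Omega] f0.
  by apply: measurable_minr; exact: mPsi.
have mf1 : measurable_fun [set: Omega] f1.
  by apply: measurable_funB => //; exact: mPsi.
have mf2 : measurable_fun [set: Omega] f2.
  by apply: measurable_funB => //; exact: mPsi.
have f00 w : (0 <= f0 w)%R by rewrite le_min !Psi0.
have f10 w : (0 <= f1 w)%R by rewrite subr_ge0 ge_min lexx.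
have f20 w : (0 <= f2 w)%R by rewrite subr_ge0 ge_min lexx orbT.
have Ef (f : Omega -> R) : measurable_fun [set: Omega] f ->
    measurable_fun [set: Omega] (fun w => (f w)%:E).
  by move=> mf; exact/measurable_EFinP.
have fin (f : Omega -> R) z : ~ M z -> measurable_fun [set: Omega] f ->
    (forall w, 0 <= f w <= Psi w z)%R -> \int[P]_w (f w)%:E < +oo.
  move=> Mz mf fz; apply: (@le_lt_trans _ _ (\int[P]_w (Psi w z)%:E)).
    apply: ge0_le_integral => //.
    - by move=> w _; rewrite lee_fin; case/andP: (fz w).
    - exact: Ef.
    - by apply: Ef; exact: mPsi.
    - by move=> w _; rewrite lee_fin; case/andP: (fz w).
  by rewrite PsiE// ltry.
have fin0 : \int[P]_w (f0 w)%:E < +oo.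
  by apply: (fin _ x) => // w; rewrite f00 ge_min lexx.
have fin1 : \int[P]_w (f1 w)%:E < +oo.
  by apply: (fin _ x) => // w; rewrite f10 gerBl f00.
have fin2 : \int[P]_w (f2 w)%:E < +oo.
  by apply: (fin _ y) => // w; rewrite f20 gerBl f00.
have [m [mE _]] := image_density mf0 f00 fin0 mgamma.
have [a [aE a_int]] := image_density mf1 f10 fin1 mgamma.
have [b [bE b_int]] := image_density mf2 f20 fin2 mgamma.
have mpre (A : set (borel S)) : measurable A -> measurable (gamma @^-1` A).
  by move=> mA; rewrite -[X in measurable X]setTI; exact: mgamma.
have splitx (A : set (borel S)) : measurable A -> mu A = m A + a A.
  move=> mA; rewrite muE// mE// aE// -ge0_integralD//; last 5 first.
  - exact: mpre.
  - by move=> w _; rewrite lee_fin.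
  - exact/measurable_funTS/Ef.
  - by move=> w _; rewrite lee_fin.
  - exact/measurable_funTS/Ef.
  by apply: eq_integral => w _; rewrite -EFinD addrC subrK.
have splity (A : set (borel S)) : measurable A -> eta A = m A + b A.
  move=> mA; rewrite etaE// mE// bE// -ge0_integralD//; last 5 first.
  - exact: mpre.
  - by move=> w _; rewrite lee_fin.
  - exact/measurable_funTS/Ef.
  - by move=> w _; rewrite lee_fin.
  - exact/measurable_funTS/Ef.
  by apply: eq_integral => w _; rewrite -EFinD addrC subrK.
(* Both totals are 1, and the finite mass of [m] can be cancelled. *)
have ab : a setT = b setT.
  have := splitx setT measurableT.
  have := splity setT measurableT.
  rewrite !probability_setT => mb ma.
  have mfin : m setT \is a fin_num by rewrite fin_num_measure.
  by rewrite -(addeK (a setT) mfin) -(addeK (b setT) mfin) -!(addeC (m setT)) -ma -mb.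
apply: (le_trans (wasserstein1_coupling_sum dens ab splitx splity
  (D := dist_to x) (mdist_to x) (dist_to_ge0 x) _)).
  by move=> u v; rewrite mdist_subspace /dist_to [X in (_ <= _ + X)%R]metric_sym metric_triangle.
have mD : measurable_fun [set: borel S] (fun u : borel S => (dist_to x u)%:E).
  exact/measurable_EFinP.
have D0 u : 0 <= (dist_to x u)%:E by rewrite lee_fin.
have -> := a_int _ mD D0; have -> := b_int _ mD D0.
rewrite -ge0_integralD//; last 4 first.
- by move=> w _; rewrite mule_ge0// lee_fin.
- by apply: emeasurable_funM; apply: Ef.
- by move=> w _; rewrite mule_ge0// lee_fin.
- by apply: emeasurable_funM; apply: Ef.
case: gentle => _ _ _ _ /(_ x y); apply: le_trans.
(* At each [w] one of the excesses is zero, so [f1 w + f2 w] is the absolute difference of the two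
   values of [Psi]. *)
rewrite le_eqVlt; apply/orP; left; apply/eqP; apply: eq_integral => w _.
rewrite -!EFinM -EFinD -mulrDr; congr ((_ * _)%:E); rewrite /f1 /f2 /f0.
by case: (lerP (Psi w x) (Psi w y)) => xy; rewrite subrr ?add0r ?addr0.
Qed.

Lemma induced_strong_random_projection :
  exists upsilon : X -> probability (borel S) R,
    induced_projection P Psi gamma upsilon /\
    strong_random_projection K upsilon.
Proof.
have [upsilon upsP] := choice projection_exists.
exists upsilon; split; first split.
- by move=> m A mA; case: (upsP (subspace_val m)) => + _; exact.
- by move=> x A Mx mA; case: (upsP x) => _ /(_ Mx)[+ _]; exact.
have mdist1 (m : S) : measurable_fun [set: borel S]
    (fun u : borel S => (mdist (m : S) (u : S))%:E).
  apply/measurable_EFinP; apply: continuous_borel_measurable.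
  exact: mdist_continuous.
have onM x m (h : borel S -> \bar R) : subspace_val m = x ->
    measurable_fun [set: borel S] h -> \int[upsilon x]_u h u = h m.
  by move=> mx mh; apply: integral_eq_dirac => // A; case: (upsP x) => + _; exact.
(* This one bound gives the finite first moment off [M] and the Lipschitz estimate between a point
   of [M] and a point outside. *)
have offM x m : ~ M x -> \int[upsilon x]_u (mdist (m : S) (u : S))%:E <=
    (K * mdist (subspace_val m) x)%:E.
  move=> Mx; case: (upsP x) => _ /(_ Mx)[_ ->]//; last first.
    by move=> u; rewrite lee_fin mdist_ge0.
  apply: le_trans (moment m Mx); rewrite le_eqVlt; apply/orP; left; apply/eqP.
  by apply: eq_integral => w _; rewrite metric_sym.
have onMx x : M x -> exists m : S, subspace_val m = x.
  by move=> Mx; exists (exist _ x (mem_set Mx)).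
split.
- move=> x; have [/onMx[m mx]|Mx] := pselect (M x).
    by exists m; rewrite (onM _ _ _ mx)// ltry.
  by exists point; apply: le_lt_trans (offM x point Mx) _; rewrite ltry.
- by move=> m A mA; case: (upsP (subspace_val m)) => + _; exact.
move=> x y; have [/onMx[m mx]|Mx] := pselect (M x).
  apply: (le_trans (wasserstein1_product dens _ _)).
  rewrite (onM _ _ _ mx); last first.
    exact: (measurable_integral_mdist dens (upsilon y)).
  have [/onMx[m' my]|My] := pselect (M y).
    rewrite (onM _ _ _ my)// lee_fin -mx -my.
    (* Two Dirac masses are at the distance of their points, so [1 <= K] enters here. *)
    by rewrite ler_peMl ?mdist_ge0.
  by rewrite -mx; exact: offM.
have [/onMx[m my]|My] := pselect (M y).
  apply: (le_trans (wasserstein1_product dens _ _)).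
  under eq_integral do rewrite (onM _ _ _ my)// metric_sym.
  by rewrite (metric_sym x) -my; exact: offM.
exact: split_coupling (upsP x) (upsP y).
Qed.

End induced_random_projection.

(** * Packing, greedy nets, distance to a set *)

Lemma half_ball_cover_iter (R : realType) (X : metricType R) (L : nat) :
  half_ball_cover X L -> forall (k : nat) (x : X) (r : R), 0 < r ->
  exists c : nat -> X, forall y, mdist x y < r ->
    exists2 j, (j < L ^ k)%N & mdist (c j) y < r / 2 ^+ k.
Proof.
move=> cov; elim=> [|k IH] x r r0.
  by exists (fun=> x) => y xy; exists 0%N; rewrite ?expn0// expr0 divr1.
have [c cP] := IH x r r0.
have rk0 : 0 < r / 2 ^+ k by rewrite divr_gt0// exprn_gt0.
have /choice[f fP] z : exists f : 'I_L -> X,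
    ball z (r / 2 ^+ k) `<=` \bigcup_i ball (f i) (r / 2 ^+ k / 2).
  exact: cov.
(* Ball [j] of the new cover is ball [j mod L] in the cover of the old ball number [j / L]. *)
exists (fun j => if insub (j %% L)%N is Some i then f (c (j %/ L)%N) i else x).
move=> y /cP[j jL jy].
have /fP[i _] : ball (c j) (r / 2 ^+ k) y by rewrite ballEmdist.
rewrite ballEmdist/= => iy.
have L0 : (0 < L)%N by case: (L) i {iy} => // -[].
exists (j * L + i)%N; first by rewrite expnSr; have := ltn_ord i; nia.
rewrite modnMDl modn_small// divnMDl// divn_small// addn0.
case: insubP => [i' _ ii'|]; last by rewrite ltn_ord.
have -> : i' = i by exact: val_inj.
by rewrite exprSr invfM mulrA.
Qed.

(** Pigeonhole: [L ^ k] balls of radius [r / 2 ^ k] cover the large ball, and two points in the same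
    one are closer than [2 * (r / 2 ^ k)]. *)
Lemma separated_size (R : realType) (X : metricType R) (L : nat) :
  half_ball_cover X L -> forall (k : nat) (x : X) (r : R) (s : nat -> X)
    (l : seq nat), 0 < r -> uniq l ->
  (forall i, i \in l -> mdist x (s i) < r) ->
  (forall i j, i \in l -> j \in l -> (j < i)%N ->
     2 * (r / 2 ^+ k) <= mdist (s i) (s j)) ->
  (size l <= L ^ k)%N.
Proof.
move=> cov k x r s l r0 ul lr sep.
have [c cP] := half_ball_cover_iter cov k x r0.
pose f i := xget 0%N [set j | (j < L ^ k)%N /\ mdist (c j) (s i) < r / 2 ^+ k].
have fP i : i \in l -> (f i < L ^ k)%N /\ mdist (c (f i)) (s i) < r / 2 ^+ k.
  move=> /lr /cP[j jL jy]; rewrite /f; case: xgetP => [_ -> //|/(_ j)].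
  by case.
have sepf i j : i \in l -> j \in l -> (j < i)%N -> f i <> f j.
  move=> il jl ji fij.
  have := sep i j il jl ji; apply/negP; rewrite -ltNge.
  have [_ fi] := fP i il; have [_ fj] := fP j jl.
  have := metric_triangle (s i) (c (f i)) (s j).
  rewrite (metric_sym (s i) (c (f i))) {2}fij => ?; lra.
have finj : {in l &, injective f}.
  move=> i j il jl fij; case: (ltngtP i j) => // ij.
    by have := sepf j i jl il ij; rewrite fij.
  by have := sepf i j il jl ij; rewrite fij.
rewrite -(size_map f) -(size_iota 0 (L ^ k)); apply: uniq_leq_size.
  by rewrite map_inj_in_uniq.
move=> _ /mapP[i il ->]; rewrite mem_iota add0n /=.
by have [] := fP i il.
Qed.

(** Scan the integers in order, keeping [k] exactly when [P k] holds and [r k j] holds for every [j]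
    already kept; [net n] lists what is kept below [n]. Whether [j] is kept is settled at stage
    [j.+1]. *)
Lemma greedy_subset (P : nat -> Prop) (r : nat -> nat -> Prop) :
  exists W : nat -> bool, forall k,
    W k <-> P k /\ forall j, (j < k)%N -> W j -> r k j.
Proof.
pose net := fix net n : seq nat := if n is k.+1 then
  (if `[< P k /\ forall j, j \in net k -> r k j >] then k :: net k else net k)
  else [::].
have netS k : net k.+1 =
  if `[< P k /\ forall j, j \in net k -> r k j >] then k :: net k else net k.
  by [].
have net_lt n j : j \in net n -> (j < n)%N.
  elim: n => [|n IH]; first by [].
  rewrite netS; case: ifP => _; last by move/IH/ltnW.
  by rewrite inE => /predU1P[->//|/IH/ltnW].
have netE k : (k \in net k.+1) =
    `[< P k /\ forall j, j \in net k -> r k j >].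
  rewrite netS; case: ifP => [_|_]; first exact: mem_head.
  by apply/negbTE/negP => /net_lt; rewrite ltnn.
have net_mono n j : (j < n)%N -> (j \in net n) = (j \in net j.+1).
  elim: n => // n IH; rewrite ltnS leq_eqVlt => /predU1P[->//|jn].
  rewrite -IH// netS; case: ifP => // _.
  by rewrite inE ltn_eqF.
exists (fun k => k \in net k.+1) => k; rewrite netE; split.
  move=> /asboolP[Pk kr]; split => // j jk Wj; apply: kr.
  by rewrite net_mono.
move=> [Pk kr]; apply/asboolP; split => // j jk.
have jltk := net_lt _ _ jk.
by apply: kr => //; rewrite -(net_mono k _ jltk).
Qed.

Section distance_to_set.
Context (R : realType) (X : metricType R) (M : set X) (M0 : M !=set0).

Definition setdist (x : X) : R := inf [set mdist x m | m in M].

Let has_inf_dist x : has_inf [set mdist x m | m in M].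
Proof.
split; first by case: M0 => m Mm; exists (mdist x m); exists m.
by exists 0 => _ [m _ <-]; exact: mdist_ge0.
Qed.

Lemma setdist_le x m : M m -> setdist x <= mdist x m.
Proof.
by move=> Mm; apply: ge_inf; [case: (has_inf_dist x)|exists m].
Qed.

Lemma le_setdist x (r : R) : (forall m, M m -> r <= mdist x m) -> r <= setdist x.
Proof.
move=> rM; apply: lb_le_inf; first by case: (has_inf_dist x).
by move=> _ [m Mm <-]; exact: rM.
Qed.

Lemma setdist_ge0 x : 0 <= setdist x.
Proof. by apply: le_setdist => m _; exact: mdist_ge0. Qed.

Lemma setdist_triangle x y : setdist x <= mdist x y + setdist y.
Proof.
rewrite -lerBlDl; apply: le_setdist => m Mm; rewrite lerBlDl.
by apply: le_trans (setdist_le x Mm) _; exact: metric_triangle.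
Qed.

Lemma setdist_eq0 x : M x -> setdist x = 0.
Proof.
by move=> Mx; apply/eqP; rewrite eq_le setdist_ge0 -(mdistxx x) setdist_le.
Qed.

Lemma setdist_gt0 x : closed M -> ~ M x -> 0 < setdist x.
Proof.
move=> cM Mx; have : open (~` M) by rewrite openC.
rewrite openE => /(_ x Mx) /nbhs_ballP[e /= e0 xe].
apply: (lt_le_trans e0); apply: le_setdist => m Mm.
rewrite leNgt; apply/negP => xm; apply: (xe m) Mm.
by rewrite ballEmdist.
Qed.

Lemma setdist_attained x (r : R) : setdist x < r -> exists2 m, M m & mdist x m < r.
Proof.
have [ne _] := has_inf_dist x.
by move=> /(inf_lt ne)[_ [m Mm <-] mr]; exists m.
Qed.

End distance_to_set.

Lemma ln2_ge_half (R : realType) : 1 / 2 <= ln 2 :> R.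
Proof.
have := @le_ln1Dx R (- (1 / 2)); rewrite (_ : 1 + - (1 / 2) = 2^-1); last by field.
by rewrite lnV ?posrE// => /(_ ltac:(lra)); lra.
Qed.

(** Factor out [expR (- (A * a))] and use [1 - e^(-c) <= c] for [c = A * (b - a)]. *)
Lemma exp_decay_diff (R : realType) (A a b : R) : 0 <= A -> a <= b ->
  0 <= expR (- (A * a)) - expR (- (A * b)) <= A * (b - a) * expR (- (A * a)).
Proof.
move=> A0 ab; apply/andP; split.
  by rewrite subr_ge0 ler_expR lerN2 ler_wpM2l.
have -> : expR (- (A * b)) = expR (- (A * a)) * expR (- (A * (b - a))).
  by rewrite -expRD; congr expR; ring.
have := expR_ge1Dx (- (A * (b - a))).
have := expR_gt0 (- (A * a)).
set p := expR _; set q := expR _; set c := A * _ => p0 q1; nra.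
Qed.

(** * Normalised exponential weights on a Whitney net *)

Section truncated_exponential.
Context (R : realType) (A : R).
Hypothesis A0 : 0 <= A.

(** This function may jump at 1/2 and only serves to dominate the variation of [trunc_bump], which
    vanishes continuously there. *)
Definition trunc_exp (t : R) := if t < 1 / 2 then expR (- (A * t)) else 0.
Definition trunc_bump (t : R) :=
  if t < 1 / 2 then expR (- (A * t)) - expR (- (A * (1 / 2))) else 0.

Lemma trunc_exp_ge0 t : 0 <= trunc_exp t.
Proof. by rewrite /trunc_exp; case: ifP => // _; exact: expR_ge0. Qed.

Lemma trunc_bump_ge0 t : 0 <= trunc_bump t.
Proof.
rewrite /trunc_bump; case: ifP => // t2.
by case/andP: (exp_decay_diff A0 (ltW t2)).
Qed.

Lemma trunc_bump_lipschitz a b :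
  `|trunc_bump a - trunc_bump b| <= A * `|a - b| * (trunc_exp a + trunc_exp b).
Proof.
wlog ab : a b / a <= b => [th|].
  have [/th//|/ltW/th] := leP a b.
  by rewrite distrC (distrC b) (addrC (trunc_exp b)).
rewrite (distrC a) (ger0_norm (_ : 0 <= b - a)) ?subr_ge0//.
apply: (@le_trans _ _ (A * (b - a) * trunc_exp a)); last first.
  by rewrite ler_wpM2l ?mulr_ge0 ?subr_ge0// lerDl trunc_exp_ge0.
rewrite /trunc_bump /trunc_exp; have [a2|a2] := ltP a (1 / 2); last first.
  by rewrite ltNge (le_trans a2 ab)/= subrr normr0 mulr0.
have [b2|b2] := ltP b (1 / 2).
  have /andP[? ?] := exp_decay_diff A0 ab.
  by rewrite opprB addrA subrK ger0_norm.
(* Here [b >= 1/2], where the bump is zero; compare [a] with 1/2 instead of [b]. *)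
have /andP[e0 e1] := exp_decay_diff A0 (ltW a2).
rewrite subr0 ger0_norm//; apply: (le_trans e1).
by rewrite ler_wpM2r ?expR_ge0// ler_wpM2l// lerD2r.
Qed.

End truncated_exponential.

(** Write [u/U - v/V = (u - v)/U + v (V - U)/(U V)]. The sum of the differences also bounds
    [|V - U|], so each term contributes that sum over [U]; only [U] is left in the denominator. *)
Lemma sum_normalized_diff (R : realType) (n : nat) (u v : nat -> R) :
  (forall i, 0 <= v i) ->
  let U := \sum_(i < n) u i in let V := \sum_(i < n) v i in
  0 < U -> 0 < V ->
  \sum_(i < n) `|u i / U - v i / V| <= 2 * (\sum_(i < n) `|u i - v i|) / U.
Proof.
move=> v0 U V U0 V0; set S := \sum_(i < n) `|u i - v i|.
have UVS : `|V - U| <= S.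
  rewrite /V /U -sumrB; apply: (le_trans (ler_norm_sum _ _ _)).
  by rewrite ler_sum// => i _; rewrite distrC.
apply: (@le_trans _ _ (\sum_(i < n) (`|u i - v i| / U + v i * (`|V - U| / (U * V))))).
  apply: ler_sum => i _.
  have -> : u i / U - v i / V = (u i - v i) / U + v i * ((V - U) / (U * V)).
    by field; rewrite ?gt_eqF.
  apply: (le_trans (ler_normD _ _)).
  rewrite !normrM (ger0_norm (v0 i)) !normfV (gtr0_norm U0) normrM.
  by rewrite (gtr0_norm U0) (gtr0_norm V0).
rewrite big_split/= -mulr_suml -mulr_suml -/S -/V.
have -> : V * (`|V - U| / (U * V)) = `|V - U| / U by field; rewrite ?gt_eqF.
by rewrite -mulrDl ler_wpM2r ?invr_ge0 ?(ltW U0)// mulr2n mulrDl mul1r lerD2l.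
Qed.

Lemma sum_ord_widen (R : realType) (m n : nat) (u : nat -> R) : (m <= n)%N ->
  (forall i, (m <= i)%N -> u i = 0) -> \sum_(i < n) u i = \sum_(i < m) u i.
Proof.
move=> mn u0; rewrite -(subnKC mn) big_split_ord/= [X in _ + X]big1 ?addr0//.
by move=> i _; apply: u0; rewrite leq_addr.
Qed.

(** * Whitney nets: separation, covering and local finiteness *)

Section whitney_partition.
Context (R : realType) (X : metricType R) (M : set X) (M0 : M !=set0).
Context (L : nat) (s : nat -> X).
Hypotheses (cM : closed M) (L2 : (2 <= L)%N) (cov : half_ball_cover X L).
Hypothesis dens : dense_sequence s.
Local Notation delta := (setdist M).

Lemma whitney_net : exists W : nat -> bool,
  [/\ forall i, W i -> ~ M (s i),
      forall i j, W i -> W j -> (j < i)%N ->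
        delta (s i) / 8 <= mdist (s i) (s j) &
      forall x, ~ M x -> exists2 i, W i & mdist x (s i) <= delta x / 4].
Proof.
have [W WP] := greedy_subset (fun i => ~ M (s i))
  (fun i j => delta (s i) / 8 <= mdist (s i) (s j)).
exists W; split => [i /WP[]//|i j /WP[_ +] Wj ji|x Mx].
  by move=> /(_ j ji Wj).
have d0 := setdist_gt0 M0 cM Mx.
(* If [k] was rejected, an earlier net point is within [delta (s k) / 8] of [s k], and
   [1/16 + (17/16)/8 < 1/4]. *)
have [k xk] := dens x (divr_gt0 d0 (ltac:(by []) : 0 < 16)).
have kd := setdist_triangle M0 (s k) x.
have dk := setdist_triangle M0 x (s k).
rewrite metric_sym in kd.
have Mk : ~ M (s k).
  by move=> Mk; rewrite (setdist_eq0 M0 Mk) addr0 in dk; lra.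
have [Wk|Wk] := boolP (W k).
  by exists k => //; lra.
have [j [jk Wj djk]] :
    exists j, [/\ (j < k)%N, W j & mdist (s k) (s j) < delta (s k) / 8].
  apply: contrapT => nj; move/negP: Wk; apply; apply/WP; split => // j jk Wj.
  by rewrite leNgt; apply/negP => djk; apply: nj; exists j.
by exists j => //; have := metric_triangle x (s k) (s j); lra.
Qed.

Variables (W : nat -> bool).
Hypothesis Wsep : forall i j, W i -> W j -> (j < i)%N ->
  delta (s i) / 8 <= mdist (s i) (s j).
Hypothesis Wcov : forall x, ~ M x -> exists2 i, W i & mdist x (s i) <= delta x / 4.

(* z_i is the point s i when W i holds. *)
Definition whitney_near x i := W i && (mdist x (s i) < delta x / 2).

Lemma whitney_nearM x i : M x -> whitney_near x i = false.
Proof.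
move=> Mx; rewrite /whitney_near setdist_eq0// mul0r.
by apply/negP => /andP[_]; rewrite ltNge mdist_ge0.
Qed.

Lemma whitney_near_setdist x i : whitney_near x i -> delta x / 2 <= delta (s i) <= 3 / 2 * delta x.
Proof.
move=> /andP[_ xi]; have := setdist_triangle M0 x (s i).
have := setdist_triangle M0 (s i) x; rewrite (metric_sym (s i)) => ? ?.
by apply/andP; split; lra.
Qed.

(** Near points lie in a ball of radius [delta x / 2] and are separated by
    [delta (s i) / 8 >= delta x / 16], which is twice that radius over [2 ^ 4]. *)
Lemma whitney_near_count x n : (count (whitney_near x) (iota 0 n) <= L ^ 4)%N.
Proof.
have [Mx|Mx] := pselect (M x).
  by rewrite (eq_count (a2 := pred0)) ?count_pred0// => i; exact: whitney_nearM.
have d0 := setdist_gt0 M0 cM Mx.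
rewrite -size_filter.
apply: (@separated_size _ _ _ cov 4 x (delta x / 2) s).
- by rewrite divr_gt0.
- by rewrite filter_uniq// iota_uniq.
- by move=> i; rewrite mem_filter => /andP[/andP[]].
move=> i j; rewrite !mem_filter => /andP[ni _] /andP[nj _] ji.
have /andP[di _] := whitney_near_setdist ni.
case/andP: ni => Wi _; case/andP: nj => Wj _.
apply: le_trans (Wsep Wi Wj ji).
by rewrite (_ : 2 * _ = delta x / 16); [lra|field].
Qed.

(** The number of near indices below [n] is bounded in [n]; where it is maximal, no further near
    index can follow. *)
Lemma whitney_near_finite x : exists n, forall i, (n <= i)%N -> whitney_near x i = false.
Proof.
pose c n := count (whitney_near x) (iota 0 n).
have ex : exists m, `[< exists n, c n = m >] by exists (c 0%N); apply/asboolP; exists 0%N.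
have ub m : `[< exists n, c n = m >] -> (m <= L ^ 4)%N.
  by move=> /asboolP[n <-]; exact: whitney_near_count.
case: (ex_maxnP ex ub) => _ /asboolP[n <-] maxc.
exists n => i ni; apply/negP => xi.
have : (c i.+1 <= c n)%N by apply: maxc; apply/asboolP; exists i.+1.
rewrite /c (_ : i.+1 = n + (i.+1 - n))%N; last by rewrite subnKC// ltnW.
rewrite iotaD count_cat add0n -[X in (_ <= X)%N]addn0 leq_add2l leqn0.
rewrite -leqn0 leqNgt -has_count => /negP; apply; apply/hasP; exists i => //.
by rewrite mem_iota; lia.
Qed.

(** * Exponential weights: total mass and variation *)

Definition whitney_rate : R := 16 * ln L%:R.
Local Notation A := whitney_rate.

Let l : R := L%:R^-1.

Let L0 : 0 < L%:R :> R. Proof. by rewrite ltr0n; lia. Qed.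

Let l0 : 0 < l. Proof. by rewrite invr_gt0. Qed.

Let l2 : l <= 1 / 2.
Proof. by rewrite div1r lef_pV2 ?posrE// ler_nat. Qed.

Lemma whitney_rate_ge0 : 0 <= A.
Proof. by rewrite mulr_ge0// ln_ge0// ler1n; lia. Qed.

Let exp_rate (n : nat) : expR (- (A * (n%:R / 16))) = l ^+ n.
Proof.
rewrite /l exprVn -[X in X ^+ n]lnK ?posrE// -expRM_natl -expRN.
by congr expR; rewrite /A; field.
Qed.

Definition ratio x i := mdist x (s i) / delta x.

Definition weight x i := if W i then trunc_bump A (ratio x i) else 0.

Definition decay x i := if W i then trunc_exp A (ratio x i) else 0.

Let ratio_near x i : 0 < delta x -> (ratio x i < 1 / 2) = (mdist x (s i) < delta x / 2).
Proof. by move=> d0; rewrite ltr_pdivrMr// mulrC div1r. Qed.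

Lemma weight_ge0 x i : 0 <= weight x i.
Proof.
by rewrite /weight; case: ifP => // _; exact: trunc_bump_ge0 whitney_rate_ge0 _.
Qed.

Lemma weight_far x i : ~ M x -> whitney_near x i = false -> weight x i = 0.
Proof.
move=> Mx; rewrite /whitney_near /weight /trunc_bump ratio_near; last exact: setdist_gt0.
by case: (W i) => //= ->.
Qed.

(** The net point of ratio at most 1/4 alone contributes [l ^ 4 - l ^ 8 >= l ^ 4 / 2]. The decay
    exceeds the weight by [l ^ 8] at each of at most [L ^ 4] near indices, hence by at most [l ^ 4]
    in total, which is at most twice the mass. *)
Lemma weight_mass x n : ~ M x -> (forall i, (n <= i)%N -> whitney_near x i = false) ->
  0 < \sum_(i < n) weight x i /\
  \sum_(i < n) decay x i <= 3 * \sum_(i < n) weight x i.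
Proof.
move=> Mx xn; have d0 := setdist_gt0 M0 cM Mx.
set Z := \sum_(i < n) weight x i.
have Zl : l ^+ 4 / 2 <= Z.
  have [i Wi xi] := Wcov Mx.
  have nxi : whitney_near x i by rewrite /whitney_near Wi/=; lra.
  have ilt : (i < n)%N by rewrite ltnNge; apply/negP => /xn; rewrite nxi.
  rewrite /Z (bigD1 (Ordinal ilt))//=.
  apply: (@le_trans _ _ (weight x i)); last first.
    by rewrite lerDl sumr_ge0// => j _; exact: weight_ge0.
  have r4 : ratio x i <= 4 / 16 by rewrite ler_pdivrMr//; lra.
  rewrite /weight Wi /trunc_bump ifT; last by lra.
  have := exp_decay_diff whitney_rate_ge0 r4 => /andP[+ _].
  rewrite (_ : 1 / 2 = 8 / 16 :> R); last by field.
  rewrite !exp_rate subr_ge0 => e4; apply: le_trans (lerB e4 (lexx _)).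
  rewrite (_ : 8 = 4 + 4)%N// exprD.
  have p0 : 0 < l ^+ 4 by rewrite exprn_gt0.
  have p1 : l ^+ 4 <= 1 / 2.
    apply: le_trans l2; rewrite -[leRHS]expr1; apply: ler_wiXn2l => //.
      exact: ltW.
    by apply: le_trans l2 _; lra.
  by set p := l ^+ 4 in p0 p1 *; nra.
have p0 : 0 < l ^+ 4 by rewrite exprn_gt0.
split; first by lra.
have decayE i : decay x i = weight x i + l ^+ 8 * (whitney_near x i)%:R.
  rewrite /decay /weight /whitney_near /trunc_bump /trunc_exp ratio_near//.
  case: (W i) => /=; last by rewrite mulr0 addr0.
  case: ifP => _; last by rewrite mulr0 addr0.
  rewrite (_ : 1 / 2 = 8 / 16 :> R); last by field.
  by rewrite exp_rate mulr1 subrK.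
under eq_bigr do rewrite decayE.
rewrite big_split/= -/Z -mulr_sumr.
have cnt : \sum_(i < n) (whitney_near x i)%:R <= (L%:R) ^+ 4 :> R.
  rewrite -natr_sum -natrX ler_nat.
  apply: leq_trans (whitney_near_count x n).
  rewrite -sumn_count sumnE big_map (_ : iota 0 n = index_iota 0 n) ?big_mkord//.
  by rewrite /index_iota subn0.
have : l ^+ 8 * \sum_(i < n) (whitney_near x i)%:R <= l ^+ 4.
  apply: (@le_trans _ _ (l ^+ 8 * L%:R ^+ 4)).
    by rewrite ler_wpM2l// exprn_ge0// ltW.
  rewrite (_ : 8 = 4 + 4)%N// exprD -mulrA -exprMn mulVf ?gt_eqF//.
  by rewrite expr1n mulr1.
by set q := l ^+ 8 * _; lra.
Qed.

(** Over the common denominator the numerator splits into two differences, each at most [mdist x y],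
    with coefficients [delta x] and [mdist x (s i) < delta x / 2]; hence [3/2]. *)
Let ratio_diff x y i : 0 < delta x -> 0 < delta y -> mdist x (s i) < delta x / 2 ->
  `|ratio x i - ratio y i| <= 3 / 2 * (mdist x y / delta y).
Proof.
move=> dx dy xi.
have -> : ratio x i - ratio y i =
    (delta x * (mdist x (s i) - mdist y (s i)) +
     mdist x (s i) * (delta y - delta x)) / (delta x * delta y).
  by rewrite /ratio; field; rewrite !gt_eqF.
rewrite normrM normfV (gtr0_norm (mulr_gt0 dx dy)) ler_pdivrMr ?mulr_gt0//.
rewrite (_ : 3 / 2 * _ * _ = 3 / 2 * delta x * mdist x y); last first.
  by field; rewrite gt_eqF.
apply: (le_trans (ler_normD _ _)); rewrite !normrM (gtr0_norm dx).
rewrite (ger0_norm (mdist_ge0 _ _)).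
have d1 : `|mdist x (s i) - mdist y (s i)| <= mdist x y.
  have := metric_triangle x y (s i); have := metric_triangle y x (s i).
  by rewrite (metric_sym y x) ler_norml => ? ?; apply/andP; split; lra.
have d2 : `|delta y - delta x| <= mdist x y.
  have := setdist_triangle M0 x y; have := setdist_triangle M0 y x.
  by rewrite (metric_sym y x) ler_norml => ? ?; apply/andP; split; lra.
have p1 : delta x * `|mdist x (s i) - mdist y (s i)| <= delta x * mdist x y.
  by rewrite ler_wpM2l// ltW.
have p2 : mdist x (s i) * `|delta y - delta x| <= delta x / 2 * mdist x y.
  by rewrite ler_pM ?mdist_ge0// ltW.
by move: p1 p2; set a := delta x * `|_|; set b := mdist x (s i) * _; lra.
Qed.

Let coef_ge0 x y : 0 <= 3 * A * (mdist x y / delta x).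
Proof.
have A0 := whitney_rate_ge0.
by apply: mulr_ge0; [apply: mulr_ge0|rewrite divr_ge0 ?mdist_ge0 ?setdist_ge0].
Qed.

Lemma weight_diff x y i : ~ M x -> ~ M y -> mdist x y < delta x / 2 ->
  `|weight x i - weight y i| <=
  3 * A * (mdist x y / delta x) * (decay x i + decay y i).
Proof.
move=> Mx My xy; have dx := setdist_gt0 M0 cM Mx; have dy := setdist_gt0 M0 cM My.
have dxy : delta x / 2 <= delta y by have := setdist_triangle M0 x y; lra.
rewrite /weight /decay; case: ifP => Wi; last by rewrite subrr normr0 addr0 mulr0.
have e0 z : 0 <= trunc_exp A (ratio z i) by exact: trunc_exp_ge0.
(* Use [ratio_diff] from a point that is near [s i]. From [x] the divisor is
   [delta y >= delta x / 2], which doubles [3/2] to 3; from [y] it is [delta x]. If neither is near,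
   both weights vanish. *)
have [xi|xi] := boolP (mdist x (s i) < delta x / 2); last first.
  have [yi|yi] := boolP (mdist y (s i) < delta y / 2); last first.
    rewrite /trunc_bump !ratio_near// (negbTE xi) (negbTE yi) subrr normr0.
    by apply: mulr_ge0; rewrite ?addr_ge0 ?coef_ge0.
  apply: (le_trans (trunc_bump_lipschitz whitney_rate_ge0 _ _)).
  apply: ler_wpM2r; first exact: addr_ge0.
  rewrite (_ : 3 * A * _ = A * (3 * (mdist x y / delta x))); last by ring.
  apply: ler_wpM2l; first exact: whitney_rate_ge0.
  rewrite distrC; apply: le_trans (ratio_diff dy dx yi) _.
  rewrite (metric_sym y) ler_wpM2r ?divr_ge0 ?mdist_ge0 ?(ltW dx)//; lra.
apply: (le_trans (trunc_bump_lipschitz whitney_rate_ge0 _ _)).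
apply: ler_wpM2r; first exact: addr_ge0.
rewrite (_ : 3 * A * _ = A * (3 * (mdist x y / delta x))); last by ring.
apply: ler_wpM2l; first exact: whitney_rate_ge0.
apply: le_trans (ratio_diff dx dy xi) _.
rewrite (_ : 3 * (mdist x y / delta x) = 3 / 2 * (mdist x y / (delta x / 2))).
  2: by field; rewrite gt_eqF.
by rewrite ler_wpM2l// ler_wpM2l ?mdist_ge0// lef_pV2 ?posrE ?divr_gt0.
Qed.

(** * The normalised partition and the gentle inequality *)

Variable g : nat -> X.
Hypothesis gnear : forall i, W i -> mdist (s i) (g i) <= 2 * delta (s i).

(** Through [s i] the distance is at most [2 * (3/2) + 1/2] times [delta x], rounded up. *)
Lemma whitney_near_retract x i : whitney_near x i -> mdist (g i) x <= 4 * delta x.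
Proof.
move=> xi; have /andP[_ d1] := whitney_near_setdist xi; case/andP: xi => Wi xi.
have d0 := setdist_ge0 M0 x.
have := gnear Wi; have := metric_triangle (g i) (s i) x.
by rewrite (metric_sym (g i) (s i)) (metric_sym (s i) x); lra.
Qed.

Variable n0 : X -> nat.
Hypothesis n0P : forall x i, (n0 x <= i)%N -> whitney_near x i = false.

(** Past [n0 x] no net point is near [x], so off [M] the finite sum is the full mass of the
    weights. *)
Definition whitney_partition i x :=
  if `[< M x >] then 0 else weight x i / \sum_(j < n0 x) weight x j.
Local Notation Psi := whitney_partition.

Lemma whitney_partition_ge0 i x : 0 <= Psi i x.
Proof.
rewrite /Psi; case: ifP => // _.
by rewrite divr_ge0 ?sumr_ge0// => *; exact: weight_ge0.
Qed.

Lemma whitney_partitionM i x : M x -> Psi i x = 0.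
Proof. by move=> Mx; rewrite /Psi asboolT. Qed.

Lemma whitney_partition_far i x : whitney_near x i = false -> Psi i x = 0.
Proof.
by move=> xi; rewrite /Psi; case: ifPn => // /asboolPn Mx; rewrite weight_far ?mul0r.
Qed.

Lemma whitney_partition_sum x n : ~ M x -> (n0 x <= n)%N ->
  \sum_(i < n) Psi i x = 1.
Proof.
move=> Mx xn; rewrite (sum_ord_widen (u := Psi ^~ x) xn); last first.
  by move=> i /n0P; exact: whitney_partition_far.
have [Z0 _] := weight_mass Mx (@n0P x).
by under eq_bigr do rewrite /Psi asboolF//; rewrite -mulr_suml divff// gt_eqF.
Qed.

Let whitney_sum_le x n : (n0 x <= n)%N -> \sum_(i < n) Psi i x <= 1.
Proof.
move=> xn; have [Mx|Mx] := pselect (M x); last by rewrite whitney_partition_sum.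
by rewrite big1// => i _; rewrite whitney_partitionM.
Qed.

Lemma whitney_partition_variation x y n : ~ M x -> ~ M y ->
  mdist x y < delta x / 2 -> (n0 x <= n)%N -> (n0 y <= n)%N ->
  \sum_(i < n) `|Psi i x - Psi i y| <= 36 * A * (mdist x y / delta x).
Proof.
move=> Mx My xy xn yn; have dx := setdist_gt0 M0 cM Mx.
have far z i : (n0 z <= n)%N -> (n <= i)%N -> whitney_near z i = false.
  by move=> zn ni; apply: n0P; exact: leq_trans zn ni.
have [Ux Ex] := weight_mass Mx (fun i => far x i xn).
have [Uy Ey] := weight_mass My (fun i => far y i yn).
have PsiE z i : ~ M z -> (n0 z <= n)%N ->
    Psi i z = weight z i / \sum_(j < n) weight z j.
  move=> Mz zn; rewrite /Psi asboolF//; congr (_ / _); apply/esym.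
  by apply: sum_ord_widen zn _ => j /n0P; exact: weight_far.
under eq_bigr do rewrite !PsiE//.
have wsum : \sum_(i < n) `|weight x i - weight y i| <=
    3 * A * (mdist x y / delta x) *
    (3 * \sum_(i < n) weight x i + 3 * \sum_(i < n) weight y i).
  apply: (@le_trans _ _ (\sum_(i < n) 3 * A * (mdist x y / delta x) *
      (decay x i + decay y i))).
    by apply: ler_sum => i _; exact: weight_diff.
  by rewrite -mulr_sumr big_split/= ler_wpM2l ?lerD ?coef_ge0.
have c0 := coef_ge0 x y.
rewrite (_ : 36 * A * _ = 12 * (3 * A * (mdist x y / delta x))); last by ring.
move: wsum c0; set c := 3 * A * _; set U := \sum_(i < n) weight x i in Ux *.
set V := \sum_(i < n) weight y i in Uy * => wsum c0.
(* Stated for general [u], [v] so that it applies in either order: dividing by the larger mass gives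
   [2 * (3 + 3) = 12]. *)
have Psi_diff (u v : nat -> R) : (forall i, 0 <= v i) ->
    let U' := \sum_(i < n) u i in let V' := \sum_(i < n) v i in
    0 < U' -> 0 < V' -> V' <= U' ->
    \sum_(i < n) `|u i - v i| <= c * (3 * U' + 3 * V') ->
    \sum_(i < n) `|u i / U' - v i / V'| <= 12 * c.
  move=> v0 U' V' U'0 V'0 VU; set S := \sum_(i < n) _ => SUV.
  apply: (le_trans (sum_normalized_diff v0 U'0 V'0)).
  rewrite ler_pdivrMr// -/S -/U'.
  have : c * V' <= c * U' by rewrite ler_wpM2l.
  by move: SUV; rewrite mulrDr; lra.
have [VU|UV] := leP V U; first exact: (Psi_diff _ _ (weight_ge0 y)).
under eq_bigr do rewrite distrC.
apply: (Psi_diff _ _ (weight_ge0 x)) => //; first exact: ltW.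
by under eq_bigr do rewrite distrC; rewrite addrC.
Qed.

Lemma whitney_rate_ge1 : 1 <= A.
Proof.
have : ln 2 <= ln L%:R :> R by rewrite ler_ln ?posrE// ler_nat.
by have := ln2_ge_half R; rewrite /A; lra.
Qed.

Lemma whitney_partition_gentle x y n : (n0 x <= n)%N -> (n0 y <= n)%N ->
  \sum_(i < n) mdist (g i) x * `|Psi i x - Psi i y| <= 252 * A * mdist x y.
Proof.
move=> xn yn.
have A1 := whitney_rate_ge1.
(* For distant points the trivial bound [Psi i x + Psi i y] suffices: with [delta x <= 2d] and
   [delta y <= 3d], where [d = mdist x y], the sum is at most [(8 + 12 + 1) d], and [1 <= A]. *)
have far : delta x / 2 <= mdist x y ->
    \sum_(i < n) mdist (g i) x * `|Psi i x - Psi i y| <= 252 * A * mdist x y.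
  move=> xy; apply: (@le_trans _ _ (\sum_(i < n) (4 * delta x * Psi i x +
      (4 * delta y + mdist x y) * Psi i y))).
    apply: ler_sum => i _.
    have Px := whitney_partition_ge0 i x; have Py := whitney_partition_ge0 i y.
    apply: (@le_trans _ _ (mdist (g i) x * (Psi i x + Psi i y))).
      rewrite ler_wpM2l ?mdist_ge0// (le_trans (ler_normB _ _))//.
      by rewrite !ger0_norm.
    rewrite mulrDr lerD//.
      have [xi|xi] := boolP (whitney_near x i).
        by rewrite ler_wpM2r// whitney_near_retract.
      by rewrite whitney_partition_far ?mulr0//; exact: negbTE.
    have [yi|yi] := boolP (whitney_near y i).
      rewrite ler_wpM2r//; have := whitney_near_retract yi.
      by have := metric_triangle (g i) y x; rewrite (metric_sym y x); lra.
    by rewrite (whitney_partition_far (negbTE yi)) !mulr0.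
  rewrite big_split/= -!mulr_sumr.
  have := whitney_sum_le xn; have := whitney_sum_le yn.
  have := setdist_triangle M0 y x; rewrite (metric_sym y x).
  have := setdist_ge0 M0 x; have := setdist_ge0 M0 y; have := mdist_ge0 x y.
  set a := \sum_(i < n) Psi i x; set b := \sum_(i < n) Psi i y.
  have a0 : 0 <= a by apply: sumr_ge0 => *; exact: whitney_partition_ge0.
  have b0 : 0 <= b by apply: sumr_ge0 => *; exact: whitney_partition_ge0.
  move=> D0 dy0 dx0 dyx b1 a1.
  have : 4 * delta x * a <= 4 * delta x by rewrite ler_piMr// mulr_ge0.
  have : (4 * delta y + mdist x y) * b <= 4 * delta y + mdist x y.
    by rewrite ler_piMr// addr_ge0// mulr_ge0.
  have : mdist x y <= A * mdist x y by rewrite ler_peMl.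
  rewrite -mulrA; lra.
have [|xy] := leP (delta x / 2) (mdist x y); first exact: far.
have [Mx|Mx] := pselect (M x).
  by move: xy; rewrite setdist_eq0// mul0r ltNge mdist_ge0.
have dx := setdist_gt0 M0 cM Mx.
have dyx := setdist_triangle M0 y x; rewrite metric_sym in dyx.
have dxy := setdist_triangle M0 x y.
have My : ~ M y by move=> My; move: dxy; rewrite (setdist_eq0 M0 My); lra.
(* Now [delta y <= 3/2 * delta x], so an index near [y] has [mdist (g i) x <= 4 * delta y + mdist x
   y <= 13/2 * delta x]. The variation bound then gives [7 * 36 = 252]. *)
apply: (@le_trans _ _ (\sum_(i < n) 7 * delta x * `|Psi i x - Psi i y|)).
  apply: ler_sum => i _.
  have [xi|xi] := boolP (whitney_near x i).
    rewrite ler_wpM2r//; have := whitney_near_retract xi; lra.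
  have [yi|yi] := boolP (whitney_near y i).
    rewrite ler_wpM2r//; have := whitney_near_retract yi.
    by have := metric_triangle (g i) y x; rewrite (metric_sym y x); lra.
  by rewrite !whitney_partition_far ?subrr ?normr0 ?mulr0//; exact: negbTE.
rewrite -mulr_sumr.
have := whitney_partition_variation Mx My xy xn yn.
rewrite -(ler_pM2l (_ : 0 < 7 * delta x)) ?mulr_gt0// => /le_trans; apply.
rewrite le_eqVlt; apply/orP; left; apply/eqP; field.
by rewrite gt_eqF.
Qed.

End whitney_partition.

(** * Gentle partitions of doubling spaces *)

Lemma integral_counting_finite (R : realType) (f : nat -> R) (n : nat) :
  (forall i, 0 <= f i) -> (forall i, (n <= i)%N -> f i = 0) ->
  (\int[counting]_i (f i)%:E = (\sum_(i < n) f i)%:E)%E.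
Proof.
move=> f0 fn; rewrite ge0_integral_count; last by move=> k; rewrite lee_fin.
apply: lim_near_cst => //; near=> m.
rewrite big_mkord sumEFin; congr (_ %:E); apply: sum_ord_widen => //.
by near: m; exact: nbhs_infty_ge.
Unshelve. all: by end_near. Qed.

(** A finite infimum means that some natural number qualifies, and the least such number attains
    it. *)
Lemma doubling_constant_attained (R : realType) (X : metricType R) :
  doubling X -> exists2 L : nat,
    fine (doubling_constant X) = L%:R & half_ball_cover X L.
Proof.
move=> dX; have ex : exists n, `[< half_ball_cover X n >].
  apply: contrapT => nex; move: dX; rewrite /doubling /doubling_constant.
  rewrite (_ : [set _ | _ in _] = set0) ?ereal_inf0//.
  by rewrite -subset0 => _ [n Xn <-]; apply: nex; exists n; exact/asboolP.
case: (ex_minnP ex) => L /asboolP XL minL; exists L => //.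
rewrite (_ : doubling_constant X = L%:R%:E)//.
apply/eqP; rewrite eq_le; apply/andP; split.
  by apply: ereal_inf_lbound; exists L.
apply: le_ereal_inf_tmp => _ [n Xn <-].
by rewrite lee_fin ler_nat; apply: minL; exact/asboolP.
Qed.

(** Two points at distance [d] lie in a ball of radius [2d] and are separated by
    [2 * (2d / 2 ^ 2) = d], so [2 <= L ^ 2]. One halving would not do: the separation required would
    then equal the radius, which must exceed [d]. *)
Lemma half_ball_cover_ge2 (R : realType) (X : metricType R) (L : nat) :
  half_ball_cover X L -> (exists x y : X, x <> y) -> (2 <= L)%N.
Proof.
move=> cov [x [y /eqP]]; rewrite -mdist_gt0 => xy.
have : (2 <= L ^ 2)%N.
  apply: (@separated_size _ _ _ cov 2 x (2 * mdist x y)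
    (fun i => if i is 0%N then x else y) [:: 0%N; 1%N]) => //.
  - by rewrite mulr_gt0.
  - by move=> [|i] _; rewrite ?mdistxx ?mulr_gt0//; lra.
  - move=> [|[|i]] [|j] // _ _ _.
    rewrite (metric_sym y x) (_ : 2 * (2 * mdist x y / 2 ^+ 2) = mdist x y)//.
    by field.
by case: L {cov} => [|[|]].
Qed.

Lemma doubling_gentle_partition (R : realType) (X : metricType R) (M : set X)
    (M0 : M !=set0) (L : nat) :
  polish X -> closed M -> half_ball_cover X L -> (2 <= L)%N ->
  exists (Psi : nat -> X -> R) (gamma : nat -> subspace_of M0),
    gentle_partition (4032 * ln L%:R) (@counting nat R) Psi gamma.
Proof.
move=> pX cM cov L2.
have [x0 _] := M0.
have [s dens] := polish_dense_sequence x0 pX.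
have [W [WM Wsep Wcov]] := whitney_net M0 cM dens.
(* Indices outside the net get the default [point]; their weights are zero. *)
have /choice[gamma gammaP] i : exists m : subspace_of M0,
    W i -> mdist (s i) (subspace_val m) <= 2 * setdist M (s i).
  have [Wi|] := boolP (W i); last by exists point.
  have d0 := setdist_gt0 M0 cM (WM _ Wi).
  have [|m Mm mi] := @setdist_attained _ _ _ M0 (s i) (2 * setdist M (s i)).
    by lra.
  by exists (exist _ m (mem_set Mm)) => _; exact: ltW.
have /choice[n0 n0P] := whitney_near_finite M0 cM L2 cov Wsep.
pose Psi := whitney_partition M L s W n0.
exists Psi, gamma.
have Psi0 i x : 0 <= Psi i x by exact: whitney_partition_ge0.
have far x i : (n0 x <= i)%N -> Psi i x = 0.
  by move=> xi; apply: whitney_partition_far => //; exact: n0P.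
have A1 := whitney_rate_ge1 R L2.
split.
- split; last by move=> i x; exact: Psi0.
  by move: A1; rewrite /whitney_rate; lra.
- by move=> i x Mx; exact: whitney_partitionM.
- move=> x Mx; split; first by move=> _ A _.
  rewrite (integral_counting_finite (f := Psi ^~ x) (n := n0 x))//.
    by rewrite whitney_partition_sum.
  by move=> i; exact: far.
- by move=> _ A _.
move=> x y.
(* Beyond both cutoffs the two partition functions vanish, so the integral against the counting
   measure is a finite sum. *)
rewrite (integral_counting_finite (n := maxn (n0 x) (n0 y))
   (f := fun i => mdist (subspace_val (gamma i)) x * `|Psi i x - Psi i y|)).
- rewrite lee_fin (_ : 4032 * _ = 252 * whitney_rate R L); last first.
    by rewrite /whitney_rate; ring.
  apply: (@whitney_partition_gentle _ _ _ M0 _ _ cM L2 cov _ Wsep Wcov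
    (fun i => subspace_val (gamma i))) => //.
  + exact: leq_maxl.
  + exact: leq_maxr.
- by move=> i; rewrite mulr_ge0 ?mdist_ge0.
- by move=> i; rewrite geq_max => /andP[? ?]; rewrite !far// subrr normr0 mulr0.
Qed.

(** Here [M] is the whole space, so the normalisation condition is vacuous and the zero function
    qualifies. This is the case where [ln] of the doubling constant gives no constant at least 1. *)
Lemma one_point_gentle_partition (R : realType) (X : metricType R) (M : set X)
    (M0 : M !=set0) : (forall x y : X, x = y) ->
  gentle_partition 1 (@counting nat R) (fun=> cst 0)
    (fun=> point : subspace_of M0).
Proof.
move=> all_eq; have [m Mm] := M0.
have MT x : M x by rewrite (all_eq x m).
split=> // x y; rewrite integral0_eq ?lee_fin ?mul1r ?mdist_ge0// => i _.
by rewrite subrr normr0 mulr0.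
Qed.

(** * Passage from gentle partitions to random projections *)

Theorem theorem2p8 (R : realType) :
  (forall (X : metricType R) (M : set X) (M0 : M !=set0) (K : R)
     (d : measure_display) (Omega : measurableType d)
     (P : {measure set Omega -> \bar R}) (Psi : Omega -> X -> R)
     (gamma : Omega -> subspace_of M0),
     polish X -> closed M -> 1 <= K ->
     gentle_partition K P Psi gamma ->
     exists upsilon : X -> probability (borel (subspace_of M0)) R,
       induced_projection P Psi gamma upsilon /\
       strong_random_projection K upsilon)
  /\
  (exists2 C : R, 0 < C &
     forall X : metricType R, polish X -> doubling X ->
     forall (M : set X) (M0 : M !=set0), closed M ->
       let K := C * ln (fine (doubling_constant X)) in
       (exists upsilon : X -> probability (borel (subspace_of M0)) R,
          strong_random_projection K upsilon)
       /\ ((exists x y : X, x <> y) -> 1 <= K)).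
Proof.
have part1 (X : metricType R) (M : set X) (M0 : M !=set0) (K : R)
     (d : measure_display) (Omega : measurableType d)
     (P : {measure set Omega -> \bar R}) (Psi : Omega -> X -> R)
     (gamma : Omega -> subspace_of M0) :
     polish X -> closed M -> 1 <= K -> gentle_partition K P Psi gamma ->
     exists upsilon : X -> probability (borel (subspace_of M0)) R,
       induced_projection P Psi gamma upsilon /\
       strong_random_projection K upsilon.
  move=> pX cM K1 gentle; have [x0 _] := M0.
  have [s dens] := polish_dense_sequence x0 pX.
  have [t tdens] := subspace_dense_sequence M0 dens.
  exact: (induced_strong_random_projection tdens K1 gentle).
split; first exact: part1.
(* [4032 = 252 * 16]: the gentle constant [252 * A] with the rate [A = 16 ln L]. *)
exists 4032; first by lra.
move=> X pX dX M M0 cM K.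
have [L LE cov] := doubling_constant_attained dX.
have K1 : (exists x y : X, x <> y) -> 1 <= K.
  move=> /(half_ball_cover_ge2 cov) L2; rewrite /K LE.
  by have := whitney_rate_ge1 R L2; rewrite /whitney_rate; lra.
split => //.
have [ne|all_eq] := pselect (exists x y : X, x <> y).
  have [Psi [gamma gentle]] :=
    doubling_gentle_partition M0 pX cM cov (half_ball_cover_ge2 cov ne).
  have [|upsilon [_ ?]] := part1 _ _ M0 _ _ _ _ _ _ pX cM _ gentle.
    by rewrite -LE; exact: K1.
  by exists upsilon; rewrite /K LE.
have {}all_eq x y : x = y :> X.
  by apply: contrapT => xy; apply: all_eq; exists x, y.
(* In a one-point space the projection is built with constant 1; all distances are zero, so the
   bound is the same for every constant. *)
have [upsilon [_ [fin onM wass]]] := part1 _ _ M0 _ _ _ _ _ _ pX cM (lexx _)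
  (one_point_gentle_partition M0 all_eq).
exists upsilon; split => // x y.
have := wass x y; rewrite (all_eq y x) mdistxx !mulr0.
by [].
Qed.
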